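(* There exist a perfect set $\mathfrak{X}\subset\mathfrak{C}$, where $\mathfrak{C}\subset\mathbb{R}$ is the Cantor ternary set, and a differentiable bijection $\mathfrak{f}\colon\mathfrak{X}\to\mathfrak{X}$ such that $\mathfrak{f}'(x)=0$ for every $x\in\mathfrak{X}$. Moreover, $\mathfrak{f}$ does not have any periodic points.
   Context: The Cantor ternary set is $\mathfrak{C}=\left\{\sum_{n=0}^\infty \frac{2s(n)}{3^{n+1}}\colon s\in\{0,1\}^{\{0,1,2,\ldots\}}\right\}$. A perfect set is a non-empty closed subset of $\mathbb{R}$ with no isolated points. For a perfect set $Q\subset\mathbb{R}$, a function $h\colon Q\to\mathbb{R}$ is differentiable if for every $p\in Q$ the (finite) limit $h'(p)=\lim_{x\to p,\ x\in Q}\frac{h(x)-h(p)}{x-p}$ exists. A point $x\in \mathfrak{X}$ is a periodic point of $\mathfrak{f}$ if the $k$-fold iterate of $\mathfrak{f}$ maps $x$ to $x$ for some integer $k\geq 1$. *)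

(* Defs.v *)
From HB Require Import structures.
From mathcomp Require Import all_boot all_order all_algebra.
From mathcomp Require Import all_classical all_reals all_analysis.
Set Implicit Arguments.
Unset Strict Implicit.
Unset Printing Implicit Defensive.
Import Order.TTheory GRing.Theory Num.Theory.
Import numFieldNormedType.Exports.
Local Open Scope classical_set_scope.
Local Open Scope ring_scope.

Definition cantor_ternary (R : realType) : set R :=
  [set x | exists s : nat -> bool,
    (series (fun n : nat => 2 * (s n)%:R / 3 ^+ n.+1 : R)) @ \oo --> x].
Arguments cantor_ternary R : clear implicits.

(* Unlike the library's [perfect_set], this excludes the empty set. *)
Definition perfect (R : realType) (Q : set R) : Prop :=
  [/\ Q !=set0, closed Q & isolated Q = set0].

(* A function h : Q -> R is represented by a total function R -> R; the
   definitions below only depend on its values on Q (for p in Q): the filter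
   [within Q p^'] is that of x -> p with x in Q and x != p. *)
Definition differentiable_on (R : realType) (Q : set R) (h : R -> R) : Prop :=
  forall p : R, Q p -> cvg ((h x - h p) / (x - p) @[x --> within Q p^']).

Definition derive_on (R : realType) (Q : set R) (h : R -> R) (p : R) : R :=
  lim ((h x - h p) / (x - p) @[x --> within Q p^']).

Definition periodic_point (R : realType) (X : set R) (f : R -> R) (x : R) :
    Prop :=
  X x /\ exists2 k : nat, (1 <= k)%N & iter k f x = x.

(* Main.v *)
(** The map is the binary odometer (add one and carry) on sequences of bits,
transported to the line by an embedding [h] that writes the bit [s n] as the
ternary digit, 0 or 2, at position [expo s n], a number depending only on
[s 0, ..., s (n-1)] and strictly increasing in [n]. If [s] and [t] first differ
at [n], then so do their successors, and [|h s - h t|] is [3 ^- expo s n] up to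
a factor 3. The positions are chosen so that, for each [s] and all large [n],
[expo] at [n] grows by at least [n+1] when [s] is replaced by its successor;
difference quotients at [h s] are then at most [3 ^- n]. There is no periodic
point because the odometer acts on the first [n] bits as a cycle of length
[2 ^ n]. *)

Require Import Defs.
From mathcomp Require Import all_boot all_order all_algebra.
From mathcomp Require Import all_classical all_reals all_analysis.
From mathcomp Require Import lra zify.
Import Order.TTheory GRing.Theory Num.Theory.
Import numFieldNormedType.Exports.
Local Open Scope classical_set_scope.
Local Open Scope ring_scope.

(** * Bit sequences and the odometer *)

Definition first_diff (n : nat) (s t : nat -> bool) : Prop :=
  (forall i, (i < n)%N -> s i = t i) /\ s n != t n.

Lemma first_diff_ex (s t : nat -> bool) : s <> t -> exists n, first_diff n s t.
Proof.
move=> st; have : exists n, s n != t n.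
  apply: contrapT => nex; apply: st; apply/funext => i.
  by apply/eqP; apply: contrapT => /negP si; apply: nex; exists i.
move=> ex; exists (ex_minn ex); case: ex_minnP => n sn nmin; split=> // i ilt.
by apply/eqP; apply: contraTT ilt => /nmin; rewrite -leqNgt.
Qed.

Fixpoint carry (s : nat -> bool) (n : nat) : bool :=
  if n is m.+1 then carry s m && s m else true.

Definition odometer (s : nat -> bool) : nat -> bool :=
  fun n => s n (+) carry s n.

(** Subtraction of one: a borrow travels through the initial zeros, hence is the carry of the
    complemented bits. *)
Definition odometer_inv (s : nat -> bool) : nat -> bool :=
  fun n => s n (+) carry (fun i => ~~ s i) n.

(** * Prefixes as binary numbers, and the digit positions *)

Fixpoint prefix_val (s : nat -> bool) (n : nat) : nat :=
  if n is m.+1 then (prefix_val s m + s m * 2 ^ m)%N else 0%N.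

(* The last bit of the prefix is flipped so that the odometer increases the
   rank of every prefix of length [m.+1] except [1...10], instead of [1...11]:
   each sequence has at most one exceptional prefix. *)
Definition prefix_rank (s : nat -> bool) (n : nat) : nat :=
  if n is m.+1 then (2 ^ m.+1 + (prefix_val s m + ~~ s m * 2 ^ m))%N else 1%N.

(** The factor [n.+1] turns an increase of the rank by one into an increase of the position by
    [n.+1]. *)
Definition expo (s : nat -> bool) (n : nat) : nat := (n.+1 * prefix_rank s n)%N.

Lemma eq_carry {s t : nat -> bool} {n : nat} :
  (forall i, (i < n)%N -> s i = t i) -> carry s n = carry t n.
Proof.
elim: n => //= n IH st; rewrite (st n) // IH // => i ilt.
by apply: st; exact: ltnW.
Qed.

Lemma eq_prefix_val {s t : nat -> bool} {n : nat} :
  (forall i, (i < n)%N -> s i = t i) -> prefix_val s n = prefix_val t n.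
Proof.
elim: n => //= n IH st; rewrite (st n) // IH // => i ilt.
by apply: st; exact: ltnW.
Qed.

Lemma eq_expo {s t : nat -> bool} {n : nat} :
  (forall i, (i < n)%N -> s i = t i) -> expo s n = expo t n.
Proof.
case: n => // n st; rewrite /expo /= (st n) // (eq_prefix_val (t := t)) //.
by move=> i ilt; apply: st; exact: ltnW.
Qed.

(** Adding one turns the initial block of ones into zeros, so undoing it borrows exactly where the
    addition carried. *)
Lemma carry_odometer (s : nat -> bool) (n : nat) :
  carry (fun i => ~~ odometer s i) n = carry s n.
Proof. by elim: n => //= n ->; rewrite /odometer; case: carry; case: (s n). Qed.

Lemma carry_odometer_inv (s : nat -> bool) (n : nat) :
  carry (odometer_inv s) n = carry (fun i => ~~ s i) n.
Proof.
by elim: n => //= n ->; rewrite /odometer_inv; case: carry; case: (s n).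
Qed.

Lemma odometerK : cancel odometer odometer_inv.
Proof.
move=> s; apply/funext => n; rewrite /odometer_inv carry_odometer.
by rewrite /odometer -addbA addbb addbF.
Qed.

Lemma odometer_invK : cancel odometer_inv odometer.
Proof.
move=> s; apply/funext => n; rewrite /odometer carry_odometer_inv.
by rewrite /odometer_inv -addbA addbb addbF.
Qed.

(** The carry into bit [n] depends only on the bits below [n], so both bits at [n] are flipped or
    neither is. *)
Lemma first_diff_odometer {n : nat} {s t : nat -> bool} :
  first_diff n s t -> first_diff n (odometer s) (odometer t).
Proof.
move=> [st sn]; split=> [i ilt|]; rewrite /odometer.
  by rewrite (st _ ilt) (eq_carry (t := t)) // => j ji; apply: st; lia.
by rewrite (eq_carry st) (inj_eq (@addIb _)).
Qed.

Lemma prefix_val_odometer (s : nat -> bool) (n : nat) :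
  (prefix_val (odometer s) n + carry s n * 2 ^ n = (prefix_val s n).+1)%N.
Proof.
elim: n => //= n; rewrite /odometer expnS.
by case: carry; case: (s n) => /=; lia.
Qed.

Lemma prefix_val_lt (s : nat -> bool) (n : nat) : (prefix_val s n < 2 ^ n)%N.
Proof. by elim: n => //= n; rewrite expnS; case: (s n) => /=; lia. Qed.

Lemma prefix_val_iter_odometer (s : nat -> bool) (n k : nat) :
  prefix_val (iter k odometer s) n = prefix_val s n + k %[mod 2 ^ n].
Proof.
have stepE u : prefix_val (odometer u) n = (prefix_val u n).+1 %[mod 2 ^ n].
  by rewrite -prefix_val_odometer addnC modnMDl.
elim: k => [|k IH]; first by rewrite addn0.
by rewrite iterS stepE -addn1 -modnDml IH modnDml addn1 addnS.
Qed.

Lemma iter_odometer_neq (s : nat -> bool) (k : nat) :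
  (0 < k)%N -> iter k odometer s <> s.
Proof.
(* The first [k] bits suffice: since [0 < k < 2 ^ k], [k] is nonzero modulo [2 ^ k]. *)
move=> k0 eqs; have /eqP := prefix_val_iter_odometer s k k.
rewrite eqs -[X in X == _ %[mod _]]addn0 eqn_modDl mod0n.
by rewrite (modn_small (ltn_expl k _)) // => /eqP k00; rewrite -k00 in k0.
Qed.

(** Without a carry into bit [n], the lower bits count up by one. With a carry and [s n] set, they
    drop from [2 ^ n - 1] to 0 while the flipped last bit contributes [2 ^ n]. *)
Lemma prefix_rank_odometer (s : nat -> bool) (n : nat) :
  ~~ (carry s n && ~~ s n) ->
  prefix_rank (odometer s) n.+1 = (prefix_rank s n.+1).+1.
Proof.
move=> cs /=; have := prefix_val_odometer s n; move: cs; rewrite /odometer.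
by case: carry; case: (s n) => //= _; lia.
Qed.

Lemma carry_le (s : nat -> bool) (m n : nat) :
  (m <= n)%N -> carry s n -> carry s m.
Proof.
elim: n => [|n IH]; first by rewrite leqn0 => /eqP ->.
by rewrite leq_eqVlt => /predU1P[->//|mn] /andP[/(IH mn)].
Qed.

Lemma expo_odometer (s : nat -> bool) :
  exists M, forall n, (M <= n)%N -> (expo s n + n < expo (odometer s) n)%N.
Proof.
suff [M HM] : exists M, forall n, (M <= n)%N -> ~~ (carry s n && ~~ s n).
  exists M.+1 => -[//|n]; rewrite ltnS => /HM /prefix_rank_odometer.
  by rewrite /expo => ->; rewrite mulnS; lia.
(* An exceptional [n] must be the position of the first zero of [s]; past any zero the carry has
   died. *)
have [s1|/existsNP[k /negP sk]] := pselect (forall n, s n).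
  by exists 0%N => n _; rewrite s1 andbF.
exists k.+1 => n /carry_le ck; apply/negP => /andP[/ck/= /andP[_ sk1] _].
by rewrite sk1 in sk.
Qed.

(** The ranks of prefixes of length [n] lie between [2 ^ n] and [2 ^ n.+1 - 1], so different lengths
    use disjoint ranges. *)
Lemma prefix_rank_ltS (s : nat -> bool) (n : nat) :
  (prefix_rank s n < prefix_rank s n.+1)%N.
Proof.
case: n => [|n] /=; rewrite !expnS; first by case: (s 0%N).
have := prefix_val_lt s n.
by case: (s n); case: (s n.+1) => /=; rewrite ?expnS; lia.
Qed.

Lemma expo_ltS (s : nat -> bool) (n : nat) : (expo s n < expo s n.+1)%N.
Proof. by have := prefix_rank_ltS s n; rewrite /expo; nia. Qed.

Lemma expo_lt (s : nat -> bool) : {homo expo s : m n / (m < n)%N}.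
Proof. by apply: (homo_ltn ltn_trans); exact: expo_ltS. Qed.

Lemma expo_le (s : nat -> bool) : {homo expo s : m n / (m <= n)%N}.
Proof. exact/ltnW_homo/expo_lt. Qed.

Lemma expo_inj (s : nat -> bool) : injective (expo s).
Proof.
by move=> m n eqe; case: (ltngtP m n) => // /(expo_lt s); rewrite eqe ltnn.
Qed.

Lemma expo_ge (s : nat -> bool) (n : nat) : (n <= expo s n)%N.
Proof. by elim: n => // n IH; exact: leq_ltn_trans (expo_ltS s n). Qed.

(** * Placing the bits at their digit positions *)

Definition spread (s : nat -> bool) : nat -> bool :=
  fun k => `[< exists2 n, s n & expo s n = k >].

Lemma first_diff_spread (n : nat) (s t : nat -> bool) :
  first_diff n s t -> first_diff (expo s n) (spread s) (spread t).
Proof.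
move=> [st sn].
(* A digit set before position [expo u n] comes from a bit [m < n], whose value and position are the
   same for [v]. *)
have sub u v j : (forall i, (i < n)%N -> u i = v i) ->
    (j < expo u n)%N -> spread u j -> spread v j.
  move=> uv jlt /asboolP[m um emj].
  have mn : (m < n)%N.
    by rewrite ltnNge; apply/negP => /(expo_le u); rewrite emj leqNgt jlt.
  apply/asboolP; exists m; first by rewrite -uv.
  by rewrite -emj; apply/esym/eq_expo => i im; apply: uv; exact: ltn_trans mn.
have spreadE u : spread u (expo u n) = u n.
  by apply/asboolP/idP => [[m um /expo_inj <-]//|un]; exists n.
split=> [j jlt|]; last by rewrite spreadE (eq_expo st) spreadE.
apply/idP/idP; first exact: sub.
by apply: sub; [move=> i /st|rewrite -(eq_expo st)].
Qed.

(** * Ternary expansions with digits 0 and 2 *)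

Section cantor_val.
Variable R : realType.
Implicit Types d e : nat -> bool.

Definition cantor_series d : R^nat :=
  series (fun n : nat => 2 * (d n)%:R / 3 ^+ n.+1 : R).

Definition cantor_val d : R := limn (cantor_series d).

Lemma cantor_series_bound d n : 0 <= cantor_series d n <= 1 - 3 ^- n.
Proof.
rewrite /cantor_series; elim: n => [|n].
  by rewrite /series/= big_geq // expr0 invr1 subrr lexx.
rewrite seriesEnat /= big_nat_recr //= exprS invfM.
have : (0 : R) < 3 ^- n by rewrite invr_gt0 exprn_gt0.
set u := 3 ^- n; set S := \sum_(_ <= _ < _) _.
by move=> u0 /andP[S0 S1]; case: (d n) => /=; lra.
Qed.

Lemma cantor_series_cvg d : cvgn (cantor_series d).
Proof.
apply: nondecreasing_is_cvgn.
  apply/nondecreasing_seqP => n; rewrite /cantor_series !seriesEnat /=.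
  rewrite big_nat_recr //= lerDl.
  by apply: divr_ge0; [exact: mulr_ge0|exact: exprn_ge0].
exists 1 => _ [n _ <-]; have /andP[_ /le_trans] := cantor_series_bound d n.
by apply; rewrite lerBlDr lerDl invr_ge0 exprn_ge0.
Qed.

Lemma cantor_val_ge0 d : 0 <= cantor_val d.
Proof.
apply: limr_ge; first exact: cantor_series_cvg.
by near=> n; case/andP: (cantor_series_bound d n).
Unshelve. all: by end_near. Qed.

Lemma cantor_val_le1 d : cantor_val d <= 1.
Proof.
apply: limr_le; first exact: cantor_series_cvg.
near=> n; have /andP[_ /le_trans] := cantor_series_bound d n.
by apply; rewrite lerBlDr lerDl invr_ge0 exprn_ge0.
Unshelve. all: by end_near. Qed.

Lemma cantor_valS d :
  cantor_val d = (2 * (d 0%N)%:R + cantor_val (fun n => d n.+1)) / 3.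
Proof.
apply/cvg_lim => //; rewrite -(cvg_shiftS (cantor_series d)).
rewrite (_ : (fun n => _) = fun n =>
  (2 * (d 0%N)%:R + cantor_series (fun n => d n.+1) n) / 3); last first.
  apply/funext => n; rewrite /cantor_series !seriesEnat /=.
  rewrite big_nat_recl //= expr1 [RHS]mulrDl mulr_suml; congr (_ + _).
  by apply: eq_bigr => i _; rewrite [in LHS]exprSr invfM mulrA.
apply: cvgMl; apply: cvgD; first exact: cvg_cst.
exact: cantor_series_cvg.
Qed.

(** Common first digits are peeled off by self-similarity, each scaling the distance by 1/3. When
    the first digits differ, one value lies in [0, 1/3] and the other in [2/3, 1]. *)
Lemma cantor_val_first_diff k d e : first_diff k d e ->
  3 ^- k.+1 <= `|cantor_val d - cantor_val e| <= 3 ^- k.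
Proof.
elim: k d e => [|k IH] d e [de dk]; rewrite (cantor_valS d) (cantor_valS e).
  have := cantor_val_ge0 (fun n => d n.+1).
  have := cantor_val_le1 (fun n => d n.+1).
  have := cantor_val_ge0 (fun n => e n.+1).
  have := cantor_val_le1 (fun n => e n.+1).
  rewrite expr0 expr1 invr1 ler_norml ler_normr.
  move: dk; case: (d 0%N); case: (e 0%N) => //= _ *; apply/andP;
    by (split; [apply/orP|apply/andP]); [(left; lra) || (right; lra)|split; lra].
rewrite (de 0%N) // -mulrBl opprD addrACA subrr add0r normrM.
rewrite (@ger0_norm _ 3^-1) ?invr_ge0 //.
have V3 m : 3 ^- m.+1 = 3 ^- m / 3 :> R by rewrite exprSr invfM.
rewrite (V3 k.+1) [X in _ && (_ <= X)](V3 k) !ler_pM2r ?invr_gt0 //.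
by apply: IH; split=> // i ik; exact: de.
Qed.

End cantor_val.

Lemma expV3_lt (R : realType) (eps : R) :
  0 < eps -> exists N, forall n, (N <= n)%N -> 3 ^- n < eps.
Proof.
move=> eps0; exists (Num.bound eps^-1) => n Nn.
rewrite invf_plt ?posrE ?exprn_gt0 //.
apply: lt_le_trans (archi_boundP _) _; first by rewrite invr_ge0 ltW.
by rewrite -natrX ler_nat (leq_trans Nn) // ltnW // ltn_expl.
Qed.

(** * The embedding and its perfect range *)

Section embed.
Variable R : realType.

(** The domain carries the product topology, whose compactness makes the range closed. *)
Definition embed (s : cantor_space) : R := cantor_val R (spread s).

Lemma embed_first_diff {n s t} : first_diff n s t ->
  3 ^- (expo s n).+1 <= `|embed s - embed t| <= 3 ^- expo s n.
Proof. by move/first_diff_spread; exact: cantor_val_first_diff. Qed.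

Lemma embed_inj : injective embed.
Proof.
move=> s t est; apply: contrapT => /first_diff_ex[n /embed_first_diff].
by rewrite est subrr normr0 leNgt invr_gt0 exprn_gt0.
Qed.

Lemma ler_expV3 m n : (3 ^- m <= 3 ^- n :> R) = (n <= m)%N.
Proof. by rewrite lef_pV2 ?posrE ?exprn_gt0 // ler_eXn2l ?ltr1n. Qed.

(** Turns closeness on the line into agreement of bits: a difference at some [n <= M] would already
    separate the points by [3 ^- (expo s M).+1]. *)
Lemma first_diff_embed_lt {M n s t} : first_diff n s t ->
  `|embed s - embed t| < 3 ^- (expo s M).+1 -> (M < n)%N.
Proof.
move=> /embed_first_diff/andP[+ _] => /le_lt_trans/[apply].
by rewrite ltNge ler_expV3 ltnS -ltnNge; apply: contraTT; rewrite -!leqNgt => /expo_le.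
Qed.

Lemma embed_continuous : continuous embed.
Proof.
move=> s; apply/cvgrPdist_le => eps /expV3_lt[N HN].
(* Fixing finitely many coordinates is an open condition, each factor being discrete. *)
have agree : \forall t \near s, forall i : 'I_N, (t : cantor_space) i = s i.
  apply: (@filter_forall cantor_space 'I_N (fun i t => t i = s i) (nbhs s)).
  move=> i.
  exact: (@proj_continuous nat (fun=> bool) i s [set s i] (discrete_set1 (s i))).
apply: filterS agree => t ts; have [->|/first_diff_ex[n stn]] := pselect (s = t).
  by rewrite subrr normr0 ltW // (le_lt_trans _ (HN N _)) // invr_ge0 exprn_ge0.
have /andP[_ /le_trans] := embed_first_diff stn; apply; apply/ltW/HN.
apply: leq_trans (expo_ge s n); rewrite leqNgt; apply/negP => nN.
by case: stn => _ /eqP; rewrite -(ts (Ordinal nN)).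
Qed.

Lemma range_embed_closed : closed (range embed).
Proof.
apply: compact_closed; first exact: norm_hausdorff.
apply: continuous_compact; last exact: cantor_space_compact.
exact/continuous_subspaceT/embed_continuous.
Qed.

Lemma range_embed_limit_point : range embed `<=` limit_point (range embed).
Proof.
move=> _ [s _ <-] U /nbhs_ballP[eps /= /expV3_lt[N HN] epsU].
(* Flipping a single far bit gives a different point within [3 ^- N]. *)
pose t : cantor_space := fun i => s i (+) (i == N).
have stN : first_diff N s t.
  split=> [i iN|]; rewrite /t ?eqxx; last by case: (s N).
  by rewrite (ltn_eqF iN) addbF.
exists (embed t); split; [|by exists t|].
  apply/eqP => /embed_inj ts; case: stN => _ /eqP; apply.
  by rewrite [in RHS]ts.
apply: epsU; have /andP[_ /le_lt_trans] := embed_first_diff stN; apply.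
exact/HN/expo_ge.
Qed.

Lemma range_embed_perfect : perfect (range embed).
Proof.
split; [by exists (embed point), point|exact: range_embed_closed|].
rewrite -subset0 => x ix; have Xx := isolatedS ix.
have /disj_setPS sub0 := @disjoint_isolated_limit_point _ (range embed).
by apply: (sub0 x); split=> //; exact: range_embed_limit_point.
Qed.

Lemma range_embed_sub_cantor : range embed `<=` cantor_ternary R.
Proof.
by move=> _ [s _ <-]; exists (spread s); exact: (@cantor_series_cvg R (spread s)).
Qed.

(** * The odometer on the line and its derivative *)

Definition embed_inv (x : R) : cantor_space := xget point [set s | embed s = x].

Lemma embedK : cancel embed embed_inv.
Proof.
move=> s; apply: embed_inj.
by apply: (@xgetI _ point [set t | embed t = embed s] s).
Qed.

Definition odometer_map (x : R) : R := embed (odometer (embed_inv x)).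

Lemma odometer_mapE s : odometer_map (embed s) = embed (odometer s).
Proof. by rewrite /odometer_map embedK. Qed.

Lemma odometer_map_bij : set_bij (range embed) (range embed) odometer_map.
Proof.
split.
- by move=> _ [s _ <-]; rewrite /= odometer_mapE; exists (odometer s).
- move=> _ _ /set_mem[s _ <-] /set_mem[t _ <-]; rewrite !odometer_mapE.
  by move=> /embed_inj/(can_inj odometerK) ->.
- move=> _ [s _ <-]; exists (embed (odometer_inv s)); first by eexists.
  by rewrite odometer_mapE odometer_invK.
Qed.

Lemma odometer_map_quotient_cvg0 p : range embed p ->
  (odometer_map x - odometer_map p) / (x - p) @[x --> within (range embed) p^']
    --> 0.
Proof.
move=> [s _ <-]; apply/cvgrPdist_le => eps /expV3_lt[N HN].
have [M HM] := expo_odometer s.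
(* Past [M] the positions grow under the odometer; past [N] the bound [3 ^- n] is below [eps]. *)
pose K := maxn M N.
have K0 : (0 : R) < 3 ^- (expo s K).+1 by rewrite invr_gt0 exprn_gt0.
rewrite near_withinE near_withinE; near=> x => xs [t _ tx].
have xsK : `|embed s - x| < 3 ^- (expo s K).+1.
  by near: x; exact: (@cvgr_dist_lt _ _ _ (nbhs (embed s)) _ id).
move: xs xsK; rewrite -tx => xs xsK; rewrite sub0r normrN !odometer_mapE.
have [n stn] : exists n, first_diff n s t.
  by apply: first_diff_ex => st; rewrite st eqxx in xs.
have Kn := first_diff_embed_lt stn xsK.
have [Mn Nn] : (M <= n)%N /\ (N <= n)%N by move: Kn; rewrite /K; lia.
have /andP[lo _] := embed_first_diff stn.
have /andP[_ hi] := embed_first_diff (first_diff_odometer stn).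
rewrite normrM normfV distrC (distrC (embed t)).
have d0 : 0 < `|embed s - embed t| by rewrite normr_gt0 subr_eq0 eq_sym.
rewrite ler_pdivrMr //; apply: (le_trans hi).
(* The extra factor 3 lost in the lower bound [lo] is paid for by the strict inequality in [HM]: the
   position grows by at least [n.+1], not just [n]. *)
apply: (@le_trans _ _ (3 ^- n * 3 ^- (expo s n).+1)); last first.
  by apply: ler_pM => //; rewrite ?invr_ge0 ?exprn_ge0 // ltW // HN.
by rewrite -invfM -exprD ler_expV3 addnS addnC; exact: HM.
Unshelve. all: by end_near. Qed.

(** Limits along this filter are unique because the range has no isolated point; this lets
    [derive_on], defined by [lim], be computed from convergence. *)
Lemma within_range_embed_proper p :
  range embed p -> ProperFilter (within (range embed) p^').
Proof.
move=> Xp; apply: Build_ProperFilter_ex => A.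
rewrite /within /= /dnbhs /within /= => /(range_embed_limit_point _ Xp).
by move=> [y [yp Xy Ay]]; exists y; exact: Ay.
Qed.

Lemma iter_odometer_map k s :
  iter k odometer_map (embed s) = embed (iter k odometer s).
Proof. by elim: k => //= k ->; rewrite odometer_mapE. Qed.

End embed.

Theorem mainTheorem2 (R : realType) :
  exists (X : set R) (f : R -> R),
    (perfect X /\ X `<=` cantor_ternary R) /\
    (set_bij X X f /\ differentiable_on X f) /\
    (forall x : R, X x -> derive_on X f x = 0) /\
    ~ (exists x : R, periodic_point X f x).
Proof.
exists (range (@embed R)), (@odometer_map R); split; [|split; [|split]].
- split; [exact: range_embed_perfect|exact: range_embed_sub_cantor].
- split; first exact: odometer_map_bij.
  by move=> p /odometer_map_quotient_cvg0/cvgP.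
- move=> x Xx; have FF := within_range_embed_proper _ _ Xx.
  exact/cvg_lim/odometer_map_quotient_cvg0.
- move=> [_ [[s _ <-] [k k0]]]; rewrite iter_odometer_map => /embed_inj.
  exact: iter_odometer_neq.
Qed.
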